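(* Let $p$ be a prime, let $G_n$ be a multigraph with vertices $v_1,\dots,v_n$ and adjacency matrix $\Gamma$, let $\Lambda=[I_n\,|\,\Gamma]$ over $\mathbb{Z}/p\mathbb{Z}$, and let $C_r,C_s\in(\mathbb{Z}/p\mathbb{Z})^n$ be two labellings. Then $$\Delta_{rs}(G_n)=\min\left\{\sum_{i=1}^n\chi(k'_i)>0 \;\middle|\; k'\in(\mathbb{Z}/p\mathbb{Z})^{2n},\ \Lambda k'=C_r-C_s \pmod p\right\}.$$
   Context: $G_n$ is an undirected multigraph with vertex set $\{v_1,\dots,v_n\}$; $\Gamma$ is the $n\times n$ matrix with $\Gamma_{ij}$ the number of edges between $v_i$ and $v_j$ (mod $p$), $0$ if none. Labellings are elements $L=(L_1,\dots,L_n)\in(\mathbb{Z}/p\mathbb{Z})^n$. For each $i$, $Z_i:(\mathbb{Z}/p\mathbb{Z})^n\to(\mathbb{Z}/p\mathbb{Z})^n$ replaces $L_i$ by $L_i+1\bmod p$ and leaves other entries unchanged; $X_i$ replaces each $L_j$ by $L_j+\Gamma_{ij}\bmod p$ for all $1\le j\le n$. $\langle Z_i,X_i\rangle$ is the group of maps generated by $Z_i,X_i$ under composition, $I$ is the identity map, and for $O_i\in\langle Z_i,X_i\rangle$, $\eta(O_i)=1$ if $O_i\ne I$, $\eta(O_i)=0$ if $O_i=I$. With $G_n$ originally labelled by $C_r$, the diagonal distance between $C_r$ and $C_s$ is $$\Delta_{rs}(G_n)=\min\left\{\sum_{i=1}^n\eta(O_i)>0 \;\middle|\; \prod_{i=1}^n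 O_i=L_{rs},\ O_i\in\langle Z_i,X_i\rangle,\ 1\le i\le n\right\},$$ where $\prod$ is composition and the condition $\prod O_i=L_{rs}$ means that the composed map sends the labelling $C_r$ to the labelling $C_s$. For $k'=(k'_1,\dots,k'_{2n})$ and $1\le i\le n$, $\chi(k'_i)=1$ if $k'_i\ne0$ or $k'_{i+n}\ne0$, and $\chi(k'_i)=0$ otherwise. $I_n$ is the $n\times n$ identity matrix.
   Formalization: When C_r = C_s, the formal theorem also assumes that every vertex v_i has some j ≠ i with Γ_ij ≠ 0 mod p; without this the claimed equality fails (e.g. p = 2, n = 1, no edges: the right side is 1, the left set is empty). *)

(* Defs.v *)
From HB Require Import structures.
From mathcomp Require Import all_boot all_order all_algebra all_fingroup.

Set Implicit Arguments.
Unset Strict Implicit.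
Unset Printing Implicit Defensive.

Import GRing.Theory.
Local Open Scope ring_scope.

(* Loops are allowed: an edge whose endpoint set is a singleton. *)
Record multigraph (n : nat) := Multigraph {
  edge : finType;
  ends : edge -> {set 'I_n};
  ends_card : forall e, (0 < #|ends e| <= 2)%N
}.

(* [min_pos P w] is min { w x > 0 | P x }, and None when that set is empty. *)
Definition min_pos (T : finType) (P : pred T) (w : T -> nat) : option nat :=
  omap w [pick x | [&& P x, (0 < w x)%N &
                    [forall y, P y && (0 < w y)%N ==> (w x <= w y)%N]]].

(* 'F_p is Z/pZ only for prime p. *)
Notation labelling p n := 'cV['F_p]_n.

Section Labellings.

Variables (p n : nat) (G : multigraph n).

Definition Gamma : 'M['F_p]_n :=
  \matrix_(i, j) #|[set e : edge G | ends e == [set i; j]]|%:R.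

Definition Lambda : 'M['F_p]_(n, n + n) := row_mx 1%:M Gamma.

Definition Z_fun (i : 'I_n) (L : labelling p n) : labelling p n :=
  \col_j (if j == i then L j 0 + 1 else L j 0).

Definition X_fun (i : 'I_n) (L : labelling p n) : labelling p n :=
  \col_j (L j 0 + Gamma i j).

Fact Z_fun_inj i : injective (Z_fun i).
Proof.
move=> L M /colP eqLM; apply/colP => j; have := eqLM j; rewrite !mxE.
by case: (j == i) => // /addIr.
Qed.

Fact X_fun_inj i : injective (X_fun i).
Proof.
by move=> L M /colP eqLM; apply/colP => j; have := eqLM j; rewrite !mxE => /addIr.
Qed.

Definition Z (i : 'I_n) : {perm (labelling p n)} := perm (@Z_fun_inj i).

Definition X (i : 'I_n) : {perm (labelling p n)} := perm (@X_fun_inj i).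

Definition eta (O : {perm (labelling p n)}) : nat := if O == 1%g then 0 else 1.

(* Products in {perm (labelling p n)} apply the leftmost factor first; all the Z i
   and X i are translations, so the order of composition is immaterial. *)
Definition diagonal_distance (Cr Cs : labelling p n) : option nat :=
  min_pos
    (fun O : {ffun 'I_n -> {perm (labelling p n)}} =>
       [forall i, O i \in <<[set Z i; X i]>>%g]
       && ((\prod_(i < n) O i)%g Cr == Cs))
    (fun O => \sum_(i < n) eta (O i))%N.

Definition chi (k : 'cV['F_p]_(n + n)) (i : 'I_n) : nat :=
  if (k (lshift n i) 0 != 0) || (k (rshift n i) 0 != 0) then 1 else 0.

End Labellings.

(* Main.v *)
Require Import Defs.
From HB Require Import structures.
From mathcomp Require Import all_boot all_order all_algebra all_fingroup.

(** All [Z i] and [X i] are translations, so [<Z i, X i>] consists of the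
    translations by vectors [- (a *: e_i + b *: Gamma_i)], and a family [O] with
    product sending [Cr] to [Cs] is given by coefficients [k = (a, b)] with
    [Lambda k = Cr - Cs]. Taking [(a_i, b_i) = (0, 0)] when [O i] is trivial
    makes the two weights equal; conversely the weight of [O] is at most that of
    [k]. It is still positive: if [Cr <> Cs] because [O] is not trivial, and if
    [Cr = Cs] because [e_i] and [Gamma_i] are then independent. *)

Set Implicit Arguments.
Unset Strict Implicit.
Unset Printing Implicit Defensive.

Import GRing.Theory.
Local Open Scope ring_scope.

Lemma min_pos_mem (T : finType) (P : pred T) (w : T -> nat) x :
  P x -> (0 < w x)%N ->
  exists y, [&& P y, (0 < w y)%N &
              [forall z, P z && (0 < w z)%N ==> (w y <= w z)%N]].
Proof.
move=> Px wx; pose Q := [pred y | P y && (0 < w y)%N].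
have Qx : Q x by rewrite /= Px.
case: (arg_minnP w Qx) => y /andP[Py wy] miny.
by exists y; apply/and3P; split=> //; apply/forallP => z; apply/implyP/miny.
Qed.

(** Matched elements need not have equal weights: domination in both directions bounds each minimum
    by the other, and makes both [None] together. *)
Lemma eq_min_pos (T U : finType) (P : pred T) (Q : pred U)
    (w : T -> nat) (v : U -> nat) :
    (forall x, P x -> (0 < w x)%N -> exists2 y, Q y & (0 < v y <= w x)%N) ->
    (forall y, Q y -> (0 < v y)%N -> exists2 x, P x & (0 < w x <= v y)%N) ->
  min_pos P w = min_pos Q v.
Proof.
move=> PQ QP; rewrite /min_pos.
case: pickP => [x /and3P[Px wx /forallP minx]|noP];
  case: pickP => [y /and3P[Qy vy /forallP miny]|noQ] //=.
- congr Some; apply/eqP; rewrite eqn_leq; apply/andP; split.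
  + have [z Pz /andP[wz lez]] := QP y Qy vy.
    by apply: leq_trans lez; apply: (implyP (minx z)); rewrite Pz.
  + have [z Qz /andP[vz lez]] := PQ x Px wx.
    by apply: leq_trans lez; apply: (implyP (miny z)); rewrite Qz.
- have [z Qz /andP[vz _]] := PQ x Px wx.
  by have [u] := min_pos_mem Qz vz; rewrite noQ.
- have [z Pz /andP[wz _]] := QP y Qy vy.
  by have [u] := min_pos_mem Pz wz; rewrite noP.
Qed.

Section Translations.

Variable V : finZmodType.
Implicit Types u v : V.

Definition translation v : {perm V} := perm (@addIr V v).

Lemma translation0 : translation 0 = 1%g.
Proof. by apply/permP => x; rewrite permE perm1 addr0. Qed.

Lemma translationD : {morph translation : u v / u + v >-> (u * v)%g}.
Proof. by move=> u v; apply/permP => x; rewrite permM !permE addrA. Qed.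

Lemma translationMn v m : translation (v *+ m) = (translation v ^+ m)%g.
Proof.
elim: m => [|m IHm]; first by rewrite mulr0n translation0.
by rewrite mulrSr translationD IHm expgSr.
Qed.

Lemma translation_eq1 v : translation v = 1%g -> v = 0.
Proof. by move=> /permP/(_ 0); rewrite permE perm1 add0r. Qed.

Lemma translation_sum (I : finType) (F : I -> V) :
  translation (\sum_i F i) = (\prod_i translation (F i))%g.
Proof. exact: (big_morph _ translationD translation0). Qed.

End Translations.

(** Translations by combinations of [u] and [v] are closed under product, so they form a finite
    group containing both generators. *)
Lemma gen_translationsP p n (u v : 'cV['F_p]_n) (O : {perm 'cV['F_p]_n}) :
  reflect (exists ab : 'F_p * 'F_p, O = translation (ab.1 *: u + ab.2 *: v))
          (O \in <<[set translation u; translation v]>>%g).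
Proof.
apply: (iffP idP) => [|[[a b] ->]] /=.
  pose f (ab : 'F_p * 'F_p) := translation (ab.1 *: u + ab.2 *: v).
  have fG : group_set (f @: setT).
    apply/group_setP; split.
      apply/imsetP; exists (0, 0) => //.
      by rewrite /f /= !scale0r addr0 translation0.
    move=> _ _ /imsetP[[a b] _ ->] /imsetP[[c d] _ ->].
    apply/imsetP; exists (a + c, b + d) => //.
    by rewrite /f /= -translationD !scalerDl addrACA.
  have sub : <<[set translation u; translation v]>>%g \subset Group fG.
    rewrite gen_subG; apply/subsetP => x /set2P[]->; apply/imsetP.
      by exists (1, 0); rewrite // /f /= scale1r scale0r addr0.
    by exists (0, 1); rewrite // /f /= scale1r scale0r add0r.
  by move=> /(subsetP sub)/imsetP[ab _ ->]; exists ab.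
(* Scalars of ['F_p] are images of naturals, so scaling a vector amounts to taking a power of its
   translation. *)
rewrite translationD -(natr_Zp a) -(natr_Zp b) !scaler_nat !translationMn.
by rewrite groupM // groupX // mem_gen // !inE eqxx ?orbT.
Qed.

(* Unqualified, [eta] is the constant of [HB.structures]. *)
Lemma eta_translation p n (v : 'cV['F_p]_n) :
  Defs.eta (translation v) = (v != 0).
Proof.
rewrite /Defs.eta; case: eqP => [/translation_eq1 ->|v0]; first by rewrite eqxx.
by case: eqP v0 => // ->; rewrite translation0.
Qed.

Section Coefficients.

Variables (p n : nat) (G : multigraph n).
Implicit Types (k : 'cV['F_p]_(n + n)) (i : 'I_n).

Lemma Gamma_sym i j : Gamma p G i j = Gamma p G j i.
Proof. by rewrite !mxE setUC. Qed.

Lemma Z_translation i : Z p i = translation (delta_mx i 0).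
Proof.
apply/permP => L; rewrite !permE; apply/colP => j; rewrite !mxE eqxx andbT.
by case: (j == i); rewrite ?addr0.
Qed.

Lemma X_translation i : X p G i = translation (col i (Gamma p G)).
Proof.
by apply/permP => L; rewrite !permE; apply/colP => j; rewrite !mxE setUC.
Qed.

Definition shift k i : 'cV['F_p]_n :=
  k (lshift n i) 0 *: delta_mx i 0 + k (rshift n i) 0 *: col i (Gamma p G).

Lemma sum_shift k : \sum_i shift k i = Lambda p G *m k.
Proof.
rewrite -[k in RHS]vsubmxK mul_row_col mul1mx big_split /=; congr (_ + _).
  rewrite [RHS]matrix_sum_delta; apply: eq_bigr => i _.
  by rewrite big_ord1 mxE.
apply/colP => j; rewrite summxE mxE; apply: eq_bigr => i _.
by rewrite !mxE mulrC.
Qed.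

(** The sign is there because going from [Cr] to [Cs] adds [Cs - Cr], whereas the linear system has
    right-hand side [Cr - Cs]. *)
Definition translations k : {ffun 'I_n -> {perm (labelling p n)}} :=
  [ffun i => translation (- shift k i)].

Lemma prod_translations k (Cr Cs : labelling p n) :
  ((\prod_(i < n) translations k i)%g Cr == Cs) = (Lambda p G *m k == Cr - Cs).
Proof.
under eq_bigr do rewrite ffunE.
rewrite -translation_sum permE sumrN sum_shift.
by rewrite subr_eq eq_sym addrC -subr_eq eq_sym opprK addrC.
Qed.

Lemma translations_gen k i :
  translations k i \in <<[set Z p i; X p G i]>>%g.
Proof.
rewrite Z_translation X_translation ffunE; apply/gen_translationsP.
exists (- k (lshift n i) 0, - k (rshift n i) 0).
by rewrite /= !scaleNr -opprD.
Qed.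

(** The inequality can be strict: a nonzero pair of coefficients gives the identity when it is a
    linear relation between [delta_mx i 0] and column [i] of [Gamma]. *)
Lemma eta_translations_le k i : (Defs.eta (translations k i) <= chi k i)%N.
Proof.
rewrite ffunE eta_translation oppr_eq0 /chi /shift.
have [->|_] := eqVneq (k (lshift n i) 0) 0; rewrite ?leq_b1 //.
have [->|_] := eqVneq (k (rshift n i) 0) 0; rewrite ?leq_b1 //.
by rewrite !scale0r addr0 eqxx.
Qed.

(** If the shift vanishes, its entry at the neighbour [j] kills the coefficient of [X i], and then
    its entry at [i] kills that of [Z i]. *)
Lemma eta_translations k i j :
  j != i -> Gamma p G i j != 0 -> Defs.eta (translations k i) = chi k i.
Proof.
move=> ji Gij; apply/eqP; rewrite eqn_leq eta_translations_le /=.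
rewrite ffunE eta_translation oppr_eq0 /chi.
have [s0|_] := eqVneq (shift k i) 0; last by case: ifP.
have shiftE l : k (lshift n i) 0 * (l == i)%:R
    + k (rshift n i) 0 * Gamma p G l i = 0.
  by have /colP/(_ l) := s0; rewrite /shift !mxE eqxx andbT.
have kr : k (rshift n i) 0 = 0.
  have /eqP := shiftE j; rewrite (negPf ji) mulr0 add0r mulf_eq0.
  by rewrite Gamma_sym (negPf Gij) orbF => /eqP.
have := shiftE i; rewrite kr eqxx mulr1 mul0r addr0 => ->.
by rewrite eqxx.
Qed.

Lemma translations_onto (O : {ffun 'I_n -> {perm (labelling p n)}}) :
    (forall i, O i \in <<[set Z p i; X p G i]>>%g) ->
  exists2 k, O = translations k & forall i, chi k i = Defs.eta (O i).
Proof.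
move=> OG.
(* The coefficients of [O i] need not be unique; the second conjunct imposes the zero pair on a
   trivial [O i], which gives [chi k i <= eta (O i)]. *)
have /fin_all_exists[f fP] i : exists ab : 'F_p * 'F_p,
    O i = translation (- (ab.1 *: delta_mx i 0 + ab.2 *: col i (Gamma p G)))
    /\ (O i = 1%g -> ab = (0, 0)).
  have [O1|O1] := eqVneq (O i) 1%g.
    by exists (0, 0); rewrite /= !scale0r addr0 oppr0 translation0.
  have := OG i; rewrite Z_translation X_translation.
  case/gen_translationsP => [[a b] Oi]; exists (- a, - b).
  by rewrite /= !scaleNr -opprD opprK -Oi; split=> // /eqP; rewrite (negPf O1).
pose k : 'cV['F_p]_(n + n) := col_mx (\col_i (f i).1) (\col_i (f i).2).
have kl i : k (lshift n i) 0 = (f i).1 by rewrite col_mxEu mxE.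
have kr i : k (rshift n i) 0 = (f i).2 by rewrite col_mxEd mxE.
have Ok : O = translations k.
  by apply/ffunP => i; rewrite ffunE /shift kl kr; case: (fP i).
exists k => // i; apply/eqP; rewrite eqn_leq {2}Ok eta_translations_le andbT.
rewrite /Defs.eta /chi kl kr; case: (fP i) => _ f0.
by case: (O i =P 1%g) => [/f0 ->|_]; rewrite ?eqxx //; case: ifP.
Qed.

End Coefficients.

Theorem theorem3 (p n : nat) (p_prime : prime p) (G : multigraph n)
    (Cr Cs : labelling p n)
    (no_isolated : Cr = Cs ->
       forall i : 'I_n, exists2 j : 'I_n, j != i & Gamma p G i j != 0) :
  diagonal_distance G Cr Cs =
  min_pos (fun k : 'cV['F_p]_(n + n) => Lambda p G *m k == Cr - Cs)
          (fun k => \sum_(i < n) chi k i)%N.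
Proof.
apply: eq_min_pos => [O /andP[/forallP OG OC] O_gt0|k kC k_gt0].
  have [k Ok chi_k] := translations_onto OG; exists k.
    by rewrite -prod_translations -Ok.
  by under eq_bigr do rewrite chi_k; rewrite O_gt0 leqnn.
exists (translations G k).
  rewrite prod_translations kC andbT.
  by apply/forallP => i; apply: translations_gen.
rewrite leq_sum ?andbT; last by move=> i _; apply: eta_translations_le.
(* Only positivity of the weight of the family remains. *)
have [CrCs|] := eqVneq Cr Cs.
  rewrite (eq_bigr (chi k)) // => i _.
  by have [j] := no_isolated CrCs i; apply: eta_translations.
(* A family of weight zero consists of identities, so its product fixes [Cr] and forces
   [Cr = Cs]. *)
apply: contra_neqT; rewrite -eqn0Ngt sum_nat_eq0 => /forallP eta0.
rewrite -(prod_translations G k) in kC; rewrite -(eqP kC) big1 ?perm1 // => i _.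
by have := eta0 i; rewrite /Defs.eta; case: (translations G k i =P 1%g).
Qed.
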